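(* Let $F$ be a nonbipartite graph with $n\ge 3$ vertices. Let $G_F=F\times K_2$ be the bipartite graph with adjacency matrix $\begin{pmatrix}0 & A_F\\ A_F & 0\end{pmatrix}$, and let $H_F=2F$ be the disjoint union of two copies of $F$, with adjacency matrix $\begin{pmatrix}A_F & 0\\ 0 & A_F\end{pmatrix}$. Then $G_F$ and $H_F$ are singularly cospectral but not cospectral (i.e. they form an NCSC pair).
   Context: All graphs are finite, without loops or multiple edges; $A_F$ is the adjacency matrix of $F$. Two graphs are cospectral if their adjacency matrices have the same spectrum (with multiplicities). The singular values of a graph are those of its adjacency matrix; two graphs are singularly cospectral if they have the same nonzero singular values with the same multiplicities. An NCSC pair is a pair of noncospectral singularly cospectral graphs. *)

(* Defs.v *)
From HB Require Import structures.
From mathcomp Require Import all_boot all_order all_algebra.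

Set Implicit Arguments.
Unset Strict Implicit.
Unset Printing Implicit Defensive.

Import Order.TTheory GRing.Theory Num.Theory.
Local Open Scope ring_scope.
Local Open Scope sesquilinear_scope.

Record sgraph := SGraph {
  vertex :> finType;
  edge : rel vertex;
  edge_sym : symmetric edge;
  edge_irrefl : irreflexive edge }.

Definition bipartite (G : sgraph) : Prop :=
  exists A : {set G}, forall x y : G, edge x y -> (x \in A) != (y \in A).

Section Complete.
Variable n : nat.
Definition complete_edge : rel 'I_n := fun i j => i != j.
Lemma complete_edge_sym : symmetric complete_edge.
Proof. by move=> i j; rewrite /complete_edge eq_sym. Qed.
Lemma complete_edge_irrefl : irreflexive complete_edge.
Proof. by move=> i; rewrite /complete_edge eqxx. Qed.
Definition complete := SGraph complete_edge_sym complete_edge_irrefl.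
End Complete.

Section Operations.
Variables G H : sgraph.

Definition tensor_edge : rel (G * H)%type :=
  fun u v => edge u.1 v.1 && edge u.2 v.2.
Lemma tensor_edge_sym : symmetric tensor_edge.
Proof.
by move=> u v; rewrite /tensor_edge edge_sym [edge u.2 _]edge_sym.
Qed.
Lemma tensor_edge_irrefl : irreflexive tensor_edge.
Proof. by move=> u; rewrite /tensor_edge edge_irrefl. Qed.
Definition tensor := SGraph tensor_edge_sym tensor_edge_irrefl.

Definition dunion_edge : rel (G + H)%type := fun u v =>
  match u, v with
  | inl x, inl y => edge x y
  | inr x, inr y => edge x y
  | _, _ => false
  end.
Lemma dunion_edge_sym : symmetric dunion_edge.
Proof. by move=> [x|x] [y|y] //=; apply: edge_sym. Qed.
Lemma dunion_edge_irrefl : irreflexive dunion_edge.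
Proof. by move=> [x|x] /=; apply: edge_irrefl. Qed.
Definition dunion := SGraph dunion_edge_sym dunion_edge_irrefl.
End Operations.

(* Vertices are ordered by the enumeration of the underlying finite type. *)
Definition adjmx (R : pzSemiRingType) (G : sgraph) : 'M[R]_#|G| :=
  \matrix_(i, j) (edge (enum_val i) (enum_val j))%:R.

Section Spectrum.
Variable C : numClosedFieldType.

(* The roots of the characteristic polynomial, each listed as many times as
   its multiplicity; the order of the list is irrelevant, lists being compared
   below up to perm_eq only. *)
Definition spectrum n (A : 'M[C]_n) : seq C :=
  sval (closed_field_poly_normal (char_poly A)).

Definition singular_values n (A : 'M[C]_n) : seq C :=
  [seq sqrtC x | x <- spectrum (A ^t* *m A)].

Definition cospectral (G H : sgraph) : Prop :=
  perm_eq (spectrum (adjmx C G)) (spectrum (adjmx C H)).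

Definition singularly_cospectral (G H : sgraph) : Prop :=
  perm_eq [seq s <- singular_values (adjmx C G) | s != 0]
          [seq s <- singular_values (adjmx C H) | s != 0].

Definition NCSC_pair (G H : sgraph) : Prop :=
  singularly_cospectral G H /\ ~ cospectral G H.

Lemma spectrumP n (A : 'M[C]_n) :
  char_poly A = \prod_(z <- spectrum A) ('X - z%:P).
Proof.
rewrite /spectrum; case: closed_field_poly_normal => r /= {1}->.
by rewrite (monicP (char_poly_monic A)) scale1r.
Qed.
End Spectrum.

Definition GF (F : sgraph) : sgraph := tensor F (complete 2).
Definition HF (F : sgraph) : sgraph := dunion F F.

Lemma GF_bipartite (F : sgraph) : bipartite (GF F).
Proof.
exists [set u : GF F | u.2 == ord0] => -[x i] [y j] /andP[_] /=.
rewrite !inE /= /complete_edge.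
by case: i j => [[|[|i]] //= ?] [[|[|j]] //= ?].
Qed.

Lemma adjmx_GF (R : pzSemiRingType) (F : sgraph) :
  exists2 f : 'I_#|GF F| -> 'I_(#|F| + #|F|), bijective f &
    adjmx R (GF F) = mxsub f f (block_mx 0 (adjmx R F) (adjmx R F) 0).
Proof.
pose f (k : 'I_#|GF F|) : 'I_(#|F| + #|F|) := let u : GF F := enum_val k in
  if u.2 == ord0 then lshift _ (enum_rank u.1) else rshift _ (enum_rank u.1).
have f_inj : injective f.
  move=> k l; rewrite /f => fkl; apply: enum_val_inj; move: fkl.
  case: (enum_val k) => x i; case: (enum_val l) => y j /=.
  have [i0 | i0] := eqVneq i ord0; have [j0 | j0] := eqVneq j ord0.
  - by move=> /lshift_inj/enum_rank_inj->; rewrite i0 j0.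
  - by move/eqP; rewrite eq_lrshift.
  - by move/eqP; rewrite eq_rlshift.
  - move=> /rshift_inj/enum_rank_inj->; congr (_, _); apply: val_inj.
    by case: i j i0 j0 => [[|[|i]] //= ?] [[|[|j]] //= ?].
exists f.
  apply: inj_card_bij => //; rewrite !card_ord.
  by rewrite card_prod card_ord muln2 addnn.
apply/matrixP => k l; rewrite [LHS]mxE [RHS]mxE /f.
case: (enum_val k) => x i; case: (enum_val l) => y j /=.
rewrite /tensor_edge /= /complete_edge.
have [i0 | i0] := eqVneq i ord0; have [j0 | j0] := eqVneq j ord0.
- by rewrite block_mxEul i0 j0 eqxx andbF mxE.
- by rewrite block_mxEur mxE !enum_rankK i0 eq_sym j0 andbT.
- by rewrite block_mxEdl mxE !enum_rankK j0 i0 andbT.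
- rewrite block_mxEdr mxE; suff -> : i = j by rewrite eqxx andbF.
  by apply: val_inj; case: i j i0 j0 => [[|[|i]] //= ?] [[|[|j]] //= ?].
Qed.

Lemma adjmx_HF (R : pzSemiRingType) (F : sgraph) :
  exists2 f : 'I_#|HF F| -> 'I_(#|F| + #|F|), bijective f &
    adjmx R (HF F) = mxsub f f (block_mx (adjmx R F) 0 0 (adjmx R F)).
Proof.
pose f (k : 'I_#|HF F|) : 'I_(#|F| + #|F|) :=
  match (enum_val k : F + F) with
  | inl x => lshift _ (enum_rank x)
  | inr x => rshift _ (enum_rank x)
  end.
have f_inj : injective f.
  move=> k l; rewrite /f => fkl; apply: enum_val_inj; move: fkl.
  case: (enum_val k) => x; case: (enum_val l) => y.
  - by move=> /lshift_inj/enum_rank_inj->.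
  - by move/eqP; rewrite eq_lrshift.
  - by move/eqP; rewrite eq_rlshift.
  - by move=> /rshift_inj/enum_rank_inj->.
exists f.
  by apply: inj_card_bij => //; rewrite !card_ord card_sum.
apply/matrixP => k l; rewrite [LHS]mxE [RHS]mxE /f.
case: (enum_val k) => x; case: (enum_val l) => y /=.
- by rewrite block_mxEul mxE !enum_rankK.
- by rewrite block_mxEur mxE.
- by rewrite block_mxEdl mxE.
- by rewrite block_mxEdr mxE !enum_rankK.
Qed.

(* Main.v *)
(** Both adjacency matrices have the same Gram matrix, with two diagonal blocks
    [A_F^* A_F], so their singular values agree.  If they were cospectral, the
    traces of all their powers would agree; for odd [k] the power of the
    off-diagonal block matrix has trace [0] while that of the diagonal one has
    trace [2 tr (A_F^k)], so [F] would have no closed walk of odd length.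
    Colouring each vertex by the parity of a walk from a fixed root of its
    component would then make [F] bipartite. *)

Require Import Defs.
From mathcomp Require Import all_boot all_order all_algebra perm.

Set Implicit Arguments.
Unset Strict Implicit.
Unset Printing Implicit Defensive.

Import Order.TTheory GRing.Theory Num.Theory.
Local Open Scope ring_scope.
Local Open Scope sesquilinear_scope.

(** Reindexing by a bijection permutes rows and columns by the same permutation, whose sign then
    enters the determinant squared. *)
Lemma char_poly_mxsub (R : comNzRingType) m n (f : 'I_m -> 'I_n) (A : 'M[R]_n) :
  bijective f -> char_poly (mxsub f f A) = char_poly A.
Proof.
move=> bij_f; have f_inj := bij_inj bij_f.
have eq_mn : m = n by have := bij_eq_card bij_f; rewrite !card_ord.
case: n / eq_mn f A {bij_f} f_inj => f A f_inj.
pose s := perm f_inj.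
rewrite /char_poly.
have -> : char_poly_mx (mxsub f f A) =
          row_perm s (col_perm s (char_poly_mx A)).
  by apply/matrixP => i j; rewrite !mxE !permE (inj_eq f_inj).
rewrite row_permE col_permE !det_mulmx !det_perm mulrCA -signr_addb.
by rewrite odd_permV addbb mulr1.
Qed.

Lemma mulmx_mxsub (R : pzSemiRingType) m n (f : 'I_m -> 'I_n) (A B : 'M[R]_n) :
  bijective f -> mxsub f f A *m mxsub f f B = mxsub f f (A *m B).
Proof.
move=> [g fK gK]; apply/matrixP => i j; rewrite !mxE.
rewrite [RHS](reindex f) /=; last by exists g => k _.
by apply: eq_bigr => k _; rewrite !mxE.
Qed.

(** Both claims go through one induction: in the sum for a diagonal entry, every term off the
    diagonal vanishes because [A] or [A ^+ k] is triangular. *)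
Lemma is_trig_mx_exp (R : pzSemiRingType) n (A : 'M[R]_n) k :
  is_trig_mx A -> is_trig_mx (A ^+ k) /\ forall i, (A ^+ k) i i = A i i ^+ k.
Proof.
move=> /is_trig_mxP trigA; elim: k => [|k [/is_trig_mxP trigAk diagAk]].
  by split=> [|i]; [exact: scalar_mx_is_trig | rewrite !mxE eqxx].
rewrite exprS -mulmxE; split=> [|i].
  apply/is_trig_mxP => i j lt_ij; rewrite mxE big1 // => l _.
  have [lt_il | le_li] := ltnP i l; first by rewrite trigA // mul0r.
  by rewrite trigAk ?mulr0 // (leq_ltn_trans le_li).
rewrite mxE (bigD1 i) //= diagAk exprS big1 ?addr0 // => l ne_li.
have [lt_il | lt_li | eq_il] := ltngtP i l; first by rewrite trigA // mul0r.
  by rewrite trigAk ?mulr0.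
by rewrite -(inj_eq val_inj) /= eq_il eqxx in ne_li.
Qed.

(** Linear factors are cancelled one at a time: the head of [s] is a root of the right-hand product,
    hence occurs in [t]. *)
Lemma prod_XsubC_perm_eq (R : idomainType) (s t : seq R) :
  \prod_(z <- s) ('X - z%:P) = \prod_(z <- t) ('X - z%:P) -> perm_eq s t.
Proof.
elim: s t => [|x s IHs] t eq_st.
  have /(congr1 (fun p : {poly R} => size p)) := eq_st.
  by rewrite !size_prod_XsubC; case: t {eq_st}.
have t_x : x \in t.
  by rewrite -root_prod_XsubC -eq_st root_prod_XsubC mem_head.
have perm_t := perm_to_rem t_x; rewrite perm_sym (permPl perm_t) perm_cons.
rewrite perm_sym; apply/IHs/(mulfI (negbT (polyXsubC_eq0 x))).
by move: eq_st; rewrite big_cons (perm_big _ perm_t) big_cons.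
Qed.

Section Conjugation.
Variables (R : comUnitRingType) (n : nat) (P A : 'M[R]_n).
Hypothesis unitP : P \in unitmx.

Lemma char_poly_conj : char_poly (P *m A *m invmx P) = char_poly A.
Proof.
rewrite /char_poly.
have -> : char_poly_mx (P *m A *m invmx P) =
    map_mx polyC P *m char_poly_mx A *m map_mx polyC (invmx P).
  rewrite /char_poly_mx mulmxBr mulmxBl scalar_mxC -[X in _ = X - _]mulmxA.
  by rewrite -!map_mxM mulmxV // map_mx1 mulmx1.
rewrite !det_mulmx mulrAC -det_mulmx -map_mxM mulmxV // map_mx1.
by rewrite det1 mul1r.
Qed.

Lemma mxtrace_exp_conj k : \tr ((P *m A *m invmx P) ^+ k) = \tr (A ^+ k).
Proof.
suff -> : (P *m A *m invmx P) ^+ k = P *m (A ^+ k) *m invmx P.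
  by rewrite mxtrace_mulC mulmxA mulVmx // mul1mx.
elim: k => [|k IHk]; first by rewrite !expr0 -idmxE mulmx1 mulmxV.
by rewrite !exprS IHk -!mulmxE !mulmxA mulmxKV.
Qed.

End Conjugation.

(** Schur triangularization preserves the traces of powers and the characteristic polynomial, so the
    diagonal of the triangular form lists the spectrum. *)
Lemma mxtrace_exp_spectrum (C : numClosedFieldType) n (A : 'M[C]_n) k :
  \tr (A ^+ k) = \sum_(z <- spectrum A) z ^+ k.
Proof.
(* [Schur] requires a positive dimension, so the empty matrix is treated apart. *)
case: n A => [|n] A.
  suff -> : spectrum A = [::] by rewrite big_nil /mxtrace big_ord0.
  apply: size0nil; apply: succn_inj.
  by rewrite -(size_prod_XsubC _ id) -spectrumP size_char_poly.
have [P /unitarymx_unit unitP] := Schur A (ltn0Sn n).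
rewrite /similar_to /= conjumx // => trigT.
rewrite -(mxtrace_exp_conj A unitP k); set T := _ *m _ in trigT *.
have [_ diagTk] := is_trig_mx_exp k trigT.
have perm_T : perm_eq [seq T i i | i : 'I_n.+1] (spectrum A).
  apply: prod_XsubC_perm_eq.
  by rewrite -spectrumP -(char_poly_conj A unitP) char_poly_trig // big_image.
by rewrite -(perm_big _ perm_T) /= big_image /=; apply: eq_bigr => i _.
Qed.

(** Its reflexive transitive closure is reachability by a walk of even length. *)
Definition two_step (T : finType) (e : rel T) : rel T :=
  fun u v => [exists w, e u w && e w v].

Lemma even_walk_connect (T : finType) (e : rel T) x p :
  path e x p -> ~~ odd (size p) ->
  connect (two_step e) x (last x p).
Proof.
(* Induction on a bound for the length, since each step removes two edges. *)
have [m] := ubnP (size p); elim: m x p => // m IHm x [|y [|z p]] //=.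
move=> lt_pm /and3P[exy eyz ezp]; rewrite negbK => even_p.
apply: connect_trans (connect1 _) (IHm _ _ _ ezp even_p); last exact: ltnW.
by apply/existsP; exists y; rewrite exy.
Qed.

Lemma connect_even_walk (T : finType) (e : rel T) x y :
  connect (two_step e) x y ->
  exists p, [/\ path e x p, last x p = y & ~~ odd (size p)].
Proof.
move=> /connectP[q]; elim: q x => [|z q IHq] x /=.
  by move=> _ ->; exists [::].
move=> /andP[/existsP[w /andP[exw ewz]] pathq].
move=> /(IHq _ pathq)[p [pathp lastp evp]].
by exists [:: w, z & p]; rewrite /= exw ewz negbK.
Qed.

Lemma no_odd_closed_walk_bipartite (G : sgraph) :
    (forall (x : G) p, path (@edge G) x p -> odd (size p) -> last x p != x) ->
  bipartite G.
Proof.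
move=> noodd; pose e := @edge G.
have csym : connect_sym e.
  by apply: sym_connect_sym => u v; apply: edge_sym.
(* The walk [p], the joining edge and [q] reversed form a closed walk of length
   [size p + size q + 1], which must be even. *)
have walk_parity r p q : path e r p -> path e r q ->
    e (last r p) (last r q) -> odd (size p) != odd (size q).
  move=> pathp pathq epq.
  pose c := p ++ last r q :: rev (belast r q).
  have pathc : path e r c.
    rewrite cat_path pathp /= epq rev_path.
    by rewrite (eq_path (e' := e)) // => u v; apply: edge_sym.
  have lastc : last r c = r.
    rewrite last_cat /=; case: q {pathq epq c pathc} => //= z q.
    by rewrite rev_cons last_rcons.
  have := noodd _ _ pathc; rewrite lastc eqxx size_cat /= size_rev size_belast.
  by rewrite oddD /=; case: (odd _); case: (odd _) => //= /(_ isT).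
exists [set x | connect (two_step e) (fingraph.root e x) x].
move=> x y exy; rewrite !inE.
have eq_r : fingraph.root e x = fingraph.root e y.
  exact/fingraph.rootP/connect1.
(* A single walk decides the colour of [z]: outside the class every walk from the root is odd, as an
   even one would witness membership. *)
have walk z (r := fingraph.root e z) : exists p,
    [/\ path e r p, last r p = z &
        connect (two_step e) r z = ~~ odd (size p)].
  have [c_z | nc_z] := boolP (connect _ _ z).
    have [p [? ? ?]] := connect_even_walk c_z.
    by exists p; split=> //; apply/esym.
  have: connect e r z by rewrite csym connect_root.
  move=> /connectP[p pathp lastp]; exists p; split=> //; apply/esym.
  by apply: contraNF nc_z => evp; rewrite lastp even_walk_connect.
have [p [pathp lastp ->]] := walk x; have [q [pathq lastq ->]] := walk y.
rewrite -eq_r in pathq lastq.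
have := walk_parity _ _ _ pathp pathq; rewrite lastp lastq => /(_ exy).
by case: (odd _); case: (odd _).
Qed.

Section AdjacencyPowers.
Variables (R : numDomainType) (G : sgraph).

Lemma adjmx_exp_ge0 k i j : 0 <= (adjmx R G ^+ k) i j.
Proof.
elim: k i j => [|k IHk] i j; first by rewrite mxE ler0n.
by rewrite exprS -mulmxE mxE sumr_ge0 // => l _; rewrite mxE mulr_ge0.
Qed.

(** The entry counts the walks of the given length between the two vertices, and [p] is one of
    them. *)
Lemma adjmx_exp_path_gt0 (x : G) p : path (@edge G) x p ->
  0 < (adjmx R G ^+ size p) (enum_rank x) (enum_rank (last x p)).
Proof.
elim: p x => [|y p IHp] x /=; first by rewrite mxE eqxx ltr01.
move=> /andP[exy /IHp gt0_p].
rewrite exprS -mulmxE mxE (bigD1 (enum_rank y)) //=.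
rewrite mxE !enum_rankK exy mul1r ltr_pwDl // sumr_ge0 // => l _.
by rewrite mxE mulr_ge0 // adjmx_exp_ge0.
Qed.

(** Diagonal entries of powers are nonnegative, so a zero trace makes each vanish, whereas an odd
    closed walk would make one positive. *)
Lemma mxtrace_adjmx_odd_bipartite :
  (forall k, odd k -> \tr (adjmx R G ^+ k) = 0) -> bipartite G.
Proof.
move=> tr0; apply: no_odd_closed_walk_bipartite => x p pathp oddp.
apply/eqP => lastp; have := adjmx_exp_path_gt0 pathp; rewrite lastp.
have /eqP := tr0 _ oddp; rewrite psumr_eq0 => [|i _]; last exact: adjmx_exp_ge0.
move=> /allP/(_ (enum_rank x)); rewrite mem_index_enum => /(_ isT)/eqP->.
by rewrite ltxx.
Qed.

End AdjacencyPowers.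

Section Blocks.
Variables (R : pzSemiRingType) (n : nat) (A : 'M[R]_n).

Lemma exp_diag_block k :
  block_mx A 0 0 A ^+ k = block_mx (A ^+ k) 0 0 (A ^+ k).
Proof.
elim: k => [|k IHk]; first by rewrite !expr0 -scalar_mx_block.
rewrite exprS -mulmxE IHk mulmx_block !mulmx0 !mul0mx !addr0 add0r.
by rewrite exprS mulmxE.
Qed.

(** Each multiplication by the antidiagonal matrix exchanges the two diagonals of blocks. *)
Lemma exp_antidiag_block k :
  block_mx 0 A A 0 ^+ k =
    if odd k then block_mx 0 (A ^+ k) (A ^+ k) 0
    else block_mx (A ^+ k) 0 0 (A ^+ k).
Proof.
elim: k => [|k IHk]; first by rewrite !expr0 -scalar_mx_block.
rewrite exprS -mulmxE IHk /=; case: (odd k) => /=;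
by rewrite mulmx_block !mulmx0 !mul0mx !addr0 ?add0r exprS mulmxE.
Qed.

End Blocks.

Section SingularValues.
Variable C : numClosedFieldType.

(** The list is computed from the characteristic polynomial alone, hence a literal equality and not
    just [perm_eq]. *)
Lemma eq_char_poly_spectrum m n (A : 'M[C]_m) (B : 'M[C]_n) :
  char_poly A = char_poly B -> spectrum A = spectrum B.
Proof. by rewrite /spectrum => ->. Qed.

(** A bijective reindexing commutes with conjugate transpose and product, so it merely reindexes the
    Gram matrix. *)
Lemma singular_values_mxsub m n (f : 'I_m -> 'I_n) (A : 'M[C]_n) :
  bijective f -> singular_values (mxsub f f A) = singular_values A.
Proof.
move=> bij_f; congr map; apply: eq_char_poly_spectrum.
by rewrite trmx_mxsub map_mxsub mulmx_mxsub // char_poly_mxsub.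
Qed.

Lemma singular_values_blocks n (A : 'M[C]_n) :
  singular_values (block_mx 0 A A 0) = singular_values (block_mx A 0 0 A).
Proof.
rewrite /singular_values !tr_block_mx !map_block_mx !mulmx_block.
by rewrite !trmx0 !map_mx0 !mul0mx !mulmx0 !addr0 !add0r.
Qed.

End SingularValues.

Local Close Scope sesquilinear_scope.
Local Close Scope ring_scope.

Theorem theorem4p1 (C : numClosedFieldType) (F : sgraph)
  (hn : 3 <= #|F|) (hF : ~ bipartite F) :
  NCSC_pair C (GF F) (HF F).
Proof.
have [f bij_f adjG] := adjmx_GF C F; have [g bij_g adjH] := adjmx_HF C F.
split=> [|cosp].
  rewrite /singularly_cospectral adjG adjH !singular_values_mxsub //.
  by rewrite singular_values_blocks.
apply: hF; apply: (@mxtrace_adjmx_odd_bipartite C) => k odd_k.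
move: cosp; rewrite /cospectral adjG adjH.
rewrite !(eq_char_poly_spectrum (char_poly_mxsub _ _)) // => cosp.
have: (\sum_(z <- spectrum (block_mx 0 (adjmx C F) (adjmx C F) 0)) z ^+ k =
       \sum_(z <- spectrum (block_mx (adjmx C F) 0 0 (adjmx C F))) z ^+ k)%R.
  exact: perm_big cosp.
rewrite -!mxtrace_exp_spectrum exp_diag_block exp_antidiag_block odd_k.
(* With [A] the adjacency matrix of [F], what remains is [0 = \tr (A ^+ k) + \tr (A ^+ k)], and 2 is
   nonzero in [C]. *)
rewrite !mxtrace_block !raddf0 add0r => /esym/eqP.
by rewrite -mulr2n mulrn_eq0 => /eqP.
Qed.
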